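(* Let $n\geqslant 2$ be an integer, let $k$ be an integer with $2\leqslant k\leqslant n$, and suppose that $\xi\in\mathbb{R}^{n+1}$ has coordinates linearly independent over $\mathbb{Q}$ and satisfies \[ \lim_{q\rightarrow\infty} \frac{L_{\xi,k-1}(q)}{q} =0. \] Then \[ \liminf_{q\rightarrow\infty} \frac{L_{\xi,k+1}(q)}{q}\leqslant \frac{1}{n-k+2}. \]
   Context: For a non-zero $\xi\in\mathbb{R}^{n+1}$ and $Q\geqslant 1$, let $\mathcal{C}_{\xi}(Q)=\{\mathbf{x}\in\mathbb{R}^{n+1} : \Vert\mathbf{x}\Vert\leqslant 1,\ |\mathbf{x}\cdot\xi|\leqslant Q^{-1}\}$, where $\mathbf{x}\cdot\mathbf{y}$ is the standard scalar product on $\mathbb{R}^{n+1}$ and $\Vert\cdot\Vert$ the Euclidean norm. For a convex body $\mathcal{C}$ and a lattice $\Lambda$ in $\mathbb{R}^{n+1}$, $\lambda_j(\mathcal{C};\Lambda)$ denotes the $j$-th successive minimum, i.e. the smallest $\lambda\geqslant 0$ such that $\lambda\mathcal{C}$ contains at least $j$ linearly independent elements of $\Lambda$. Define $L_{\xi,j}(q)=\log\lambda_j(\mathcal{C}_{\xi}(e^{q});\mathbb{Z}^{n+1})$ for $q\geqslant 0$ and $1\leqslant j\leqslant n+1$. *)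

(* Defs.v *)
From HB Require Import structures.
From mathcomp Require Import all_boot all_order all_algebra.
From mathcomp Require Import all_classical all_reals all_analysis.
Set Implicit Arguments.
Unset Strict Implicit.
Unset Printing Implicit Defensive.
Import Order.TTheory GRing.Theory Num.Theory numFieldNormedType.Exports.
Local Open Scope classical_set_scope.
Local Open Scope ring_scope.

Definition dotv (R : realType) (m : nat) (x y : 'rV[R]_m) : R :=
  \sum_(i < m) x ord0 i * y ord0 i.

(* The norm that the library puts on 'rV[R]_m is the sup norm. *)
Definition eucl_norm (R : realType) (m : nat) (x : 'rV[R]_m) : R :=
  Num.sqrt (dotv x x).

Definition int_lattice (R : realType) (m : nat) : set 'rV[R]_m :=
  [set x | forall i, x ord0 i \is a Num.int].

Definition cbody (R : realType) (m : nat) (xi : 'rV[R]_m) (Q : R) :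
    set 'rV[R]_m :=
  [set x | eucl_norm x <= 1 /\ `|dotv x xi| <= Q^-1].

Definition has_lin_indep (R : realType) (m j : nat) (A : set 'rV[R]_m) : Prop :=
  exists v : 'I_j -> 'rV[R]_m,
    (forall i, A (v i)) /\ row_free (\matrix_(i < j) v i).

(* For a 0-symmetric convex body C (compact, nonempty interior), a lattice Lam and
   1 <= j <= m, the infimum is attained, hence is the smallest such lambda. *)
Definition succ_min (R : realType) (m : nat) (C Lam : set 'rV[R]_m) (j : nat) :
    R :=
  inf [set lambda : R | 0 <= lambda /\
         has_lin_indep j ([set lambda *: x | x in C] `&` Lam)].

Definition log_succ_min (R : realType) (m : nat) (xi : 'rV[R]_m) (j : nat)
    (q : R) : R :=
  ln (succ_min (cbody xi (expR q)) (@int_lattice R m) j).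

Definition Q_lin_indep_coords (R : realType) (m : nat) (xi : 'rV[R]_m) : Prop :=
  forall c : 'I_m -> rat,
    \sum_(i < m) ratr (c i) * xi ord0 i = 0 -> forall i, c i = 0.

(* Main.v *)
Require Import Defs.
From HB Require Import structures.
From mathcomp Require Import all_boot all_order all_algebra.
From mathcomp Require Import all_classical all_reals all_analysis.
From mathcomp Require Import perm ring lra zify.
Set Implicit Arguments.
Unset Strict Implicit.
Unset Printing Implicit Defensive.
Import Order.TTheory GRing.Theory Num.Theory numFieldNormedType.Exports.
Local Open Scope classical_set_scope.
Local Open Scope ring_scope.

(* Write s_j for the j-th minimum at Q = e^i, with i a natural number. A pigeonhole
   argument modulo the span of the points below s_j gives s_j^(n+2-j) <= C Q. If
   s_(k+1) <= 4e s_k for arbitrarily large i, the case j = k of this bound gives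
   the theorem. Otherwise the points realizing s_k span, for large i, a subspace
   contained in one fixed rational k-dimensional subspace W; as xi does not vanish
   on W, a determinant estimate in W gives s_(k-1)^(k-1) s_k >= c Q. By hypothesis
   s_(k-1) = Q^(o(1)), so s_k >= Q^(1-o(1)), which contradicts s_k^2 <= C Q. The
   factors 2 and 4e absorb the fact that minima are only used as infima. *)

(** * Scalar product and Euclidean norm *)

Lemma dotvE (R : realType) m (x y : 'rV[R]_m) : dotv x y = (x *m y^T) ord0 ord0.
Proof. by rewrite mxE; apply: eq_bigr => i _; rewrite mxE. Qed.

Lemma dotvZl (R : realType) m (a : R) (x y : 'rV[R]_m) :
  dotv (a *: x) y = a * dotv x y.
Proof. by rewrite !dotvE -scalemxAl mxE. Qed.

Lemma dotvBl (R : realType) m (x y z : 'rV[R]_m) :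
  dotv (x - y) z = dotv x z - dotv y z.
Proof. by rewrite !dotvE mulmxBl !mxE. Qed.

Lemma dotvv_ge0 (R : realType) m (x : 'rV[R]_m) : 0 <= dotv x x.
Proof. by apply: sumr_ge0 => i _; rewrite -expr2 sqr_ge0. Qed.

Lemma eucl_normZ (R : realType) m (a : R) (x : 'rV[R]_m) :
  0 <= a -> eucl_norm (a *: x) = a * eucl_norm x.
Proof.
move=> a0; rewrite /eucl_norm dotvZl.
have -> : dotv x (a *: x) = a * dotv x x.
  by rewrite /dotv mulr_sumr; apply: eq_bigr => i _; rewrite mxE mulrCA.
by rewrite mulrA -expr2 sqrtrM ?sqr_ge0// sqrtr_sqr ger0_norm.
Qed.

Lemma coord_le_eucl_norm (R : realType) m (x : 'rV[R]_m) i :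
  `|x ord0 i| <= eucl_norm x.
Proof.
rewrite -sqrtr_sqr /eucl_norm ler_sqrt ?dotvv_ge0// /dotv (bigD1 i)//= -expr2 lerDl.
by apply: sumr_ge0 => j _; rewrite -expr2 sqr_ge0.
Qed.

Lemma eucl_norm_le_sum (R : realType) m (x : 'rV[R]_m) (a : R) :
  (forall i, `|x ord0 i| <= a) -> eucl_norm x <= m%:R * a.
Proof.
case: m x => [|m] x xa.
  by rewrite /eucl_norm /dotv big_ord0 sqrtr0 mul0r.
have a0 : 0 <= a by apply: le_trans (xa ord0).
rewrite -[leRHS]ger0_norm ?mulr_ge0// -sqrtr_sqr ler_sqrt ?sqr_ge0//.
have -> : (m.+1%:R * a) ^+ 2 = m.+1%:R * (\sum_(i < m.+1) a ^+ 2).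
  by rewrite sumr_const card_ord -mulr_natl; ring.
rewrite -[leLHS]mul1r ler_pM ?dotvv_ge0 ?ler1n//.
apply: ler_sum => i _; rewrite -expr2 -real_normK ?num_real//.
by rewrite ler_pXn2r ?nnegrE.
Qed.

(** * Independent integer points in dilates, and successive minima *)

Lemma row_free_row_neq0 (F : fieldType) p m (X : 'M[F]_(p, m)) i :
  row_free X -> row i X != 0.
Proof.
move=> /row_freeP[Y XY]; apply/eqP => x0.
have := congr1 (fun A => row i A) XY; rewrite row_mul x0 mul0mx.
by move/rowP/(_ i); rewrite !mxE eqxx => /esym /eqP; rewrite oner_eq0.
Qed.

(** The integer points of the dilate of [cbody xi Q] by [l], with the scaling moved into the bounds
    so that comparing dilates is comparing numbers. *)
Definition body_points (R : realType) m (xi : 'rV[R]_m) (Q l : R) : set 'rV[R]_m :=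
  [set x | [/\ int_lattice x, eucl_norm x <= l & `|dotv x xi| <= l / Q]].

Definition indep_points (R : realType) m (xi : 'rV[R]_m) (Q l : R) (j : nat) :=
  exists X : 'M[R]_(j, m), row_free X /\ forall i, body_points xi Q l (row i X).

Lemma body_pointsP (R : realType) m (xi : 'rV[R]_m) (Q l : R) x :
  0 < l ->
  ([set l *: y | y in cbody xi Q] `&` @int_lattice R m) x <-> body_points xi Q l x.
Proof.
move=> l0; split.
  move=> [[y [y1 yxi]] <- yint]; split => //.
    by rewrite (eucl_normZ _ (ltW l0)) ler_piMr// ltW.
  by rewrite dotvZl normrM gtr0_norm// ler_pM2l.
move=> [xint xl xxi]; split=> //; exists (l^-1 *: x).
  split; first by rewrite eucl_normZ ?invr_ge0 ?(ltW l0)// ler_pdivrMl// mulr1.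
  by rewrite dotvZl normrM gtr0_norm ?invr_gt0// ler_pdivrMl.
by rewrite scalerA mulfV ?scale1r// gt_eqF.
Qed.

Lemma has_lin_indepP (R : realType) m (xi : 'rV[R]_m) (Q l : R) j :
  0 < l ->
  has_lin_indep j ([set l *: y | y in cbody xi Q] `&` @int_lattice R m) <->
  indep_points xi Q l j.
Proof.
move=> l0; split=> [[v [vA vfree]]|[X [Xfree XA]]].
  exists (\matrix_(i < j) v i); split=> // i; rewrite rowK.
  exact/body_pointsP/vA.
exists (fun i => row i X); split => [i|]; first exact/body_pointsP.
by congr row_free: Xfree; apply/row_matrixP => i; rewrite rowK.
Qed.

Lemma indep_points_mono (R : realType) m (xi : 'rV[R]_m) (Q Q' l l' : R) j :
  l <= l' -> l / Q <= l' / Q' -> indep_points xi Q l j -> indep_points xi Q' l' j.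
Proof.
move=> ll' lQ [X [Xf XG]]; exists X; split=> // i.
by case: (XG i) => xint xl xQ; split => //; [exact: le_trans ll'|exact: le_trans lQ].
Qed.

Lemma body_points_ge1 (R : realType) m (xi : 'rV[R]_m) (Q l : R) x :
  body_points xi Q l x -> x != 0 -> 1 <= l.
Proof.
move=> [xint xl _] /eqP x0.
have [i xi0] : exists i, x ord0 i != 0.
  apply/not_existsP => H; apply: x0; apply/rowP => i; rewrite mxE.
  by apply/eqP; move: (H i) => /negP; rewrite negbK.
apply: le_trans xl; apply: le_trans (coord_le_eucl_norm x i).
exact: norm_intr_ge1.
Qed.

Lemma indep_points_ge1 (R : realType) m (xi : 'rV[R]_m) (Q l : R) j :
  indep_points xi Q l j.+1 -> 1 <= l.
Proof.
move=> [X [Xf XG]]; apply: body_points_ge1 (XG ord0) _.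
exact: row_free_row_neq0.
Qed.

(** Unit vectors serve: the term [m] of [l] covers their norm and the sum covers their scalar
    products with [xi]. The set defining [succ_min] is thus nonempty, so its [inf] is not a default
    value. *)
Lemma indep_points_exists (R : realType) m (xi : 'rV[R]_m) (Q : R) j :
  0 < Q -> (j < m)%N -> exists2 l, 0 < l & indep_points xi Q l j.+1.
Proof.
move=> Q0 jm.
pose l : R := m%:R + \sum_i `|xi ord0 i| * Q.
have B0 : 0 <= \sum_i `|xi ord0 i| * Q.
  by apply: sumr_ge0 => i _; rewrite mulr_ge0// ltW.
exists l; first by rewrite ltr_pwDl// ltr0n; case: (m) jm.
pose f := widen_ord jm.
exists (rowsub f 1%:M); split.
  apply/row_freeP; exists (colsub f 1%:M); apply/matrixP => a b.
  rewrite !mxE (bigD1 (f a))//= !mxE eqxx mul1r big1 ?addr0//.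
  by move=> c ca; rewrite !mxE eq_sym (negbTE ca) mul0r.
move=> i; split.
- by move=> a; rewrite !mxE; case: eqP => _; rewrite ?int_num0 ?int_num1.
- apply: (@le_trans _ _ (m%:R * 1)); last by rewrite mulr1 lerDl.
  apply: eucl_norm_le_sum => a; rewrite !mxE; case: eqP => _;
    by rewrite ?normr1 ?normr0.
- rewrite ler_pdivlMr// /dotv (bigD1 (f i))//= big1 ?addr0; last first.
    by move=> c ca; rewrite !mxE eq_sym (negbTE ca) mul0r.
  rewrite !mxE eqxx mul1r /l (bigD1 (f i))//= addrCA lerDl addr_ge0//.
  by apply: sumr_ge0 => c _; rewrite mulr_ge0// ltW.
Qed.

(** For [l = 0] the dilate contains only the zero vector, which is no row of a free matrix. *)
Lemma has_lin_indep_ge0 (R : realType) m (xi : 'rV[R]_m) (Q l : R) j :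
  0 <= l ->
  has_lin_indep j.+1 ([set l *: y | y in cbody xi Q] `&` @int_lattice R m) ->
  indep_points xi Q l j.+1.
Proof.
rewrite le_eqVlt => /orP[/eqP<-|l0 /has_lin_indepP]; last exact.
move=> [v [vA /(row_free_row_neq0 ord0)]]; rewrite rowK.
by case: (vA ord0) => -[y _ <-] _; rewrite scale0r eqxx.
Qed.

Lemma succ_min_le (R : realType) m (xi : 'rV[R]_m) (Q l : R) j :
  indep_points xi Q l j.+1 -> succ_min (cbody xi Q) (@int_lattice R m) j.+1 <= l.
Proof.
move=> H; have l1 := indep_points_ge1 H; have l0 : 0 < l by exact: lt_le_trans l1.
apply: ge_inf; first by exists 0 => x [].
by split; [exact: ltW | exact/has_lin_indepP].
Qed.

Lemma succ_min_ge1 (R : realType) m (xi : 'rV[R]_m) (Q : R) j :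
  0 < Q -> (j < m)%N -> 1 <= succ_min (cbody xi Q) (@int_lattice R m) j.+1.
Proof.
move=> Q0 jm; apply: lb_le_inf.
  have [l l0 H] := indep_points_exists xi Q0 jm.
  by exists l; split; [exact: ltW|exact/has_lin_indepP].
by move=> x [x0 /(has_lin_indep_ge0 x0) /indep_points_ge1].
Qed.

(** Attainment of the infimum is avoided: some admissible factor lies below [l], and dilates grow
    with the factor. *)
Lemma succ_min_lt (R : realType) m (xi : 'rV[R]_m) (Q l : R) j :
  0 < Q -> (j < m)%N -> succ_min (cbody xi Q) (@int_lattice R m) j.+1 < l ->
  indep_points xi Q l j.+1.
Proof.
rewrite /succ_min => Q0 jm; set S := [set _ | _]; rewrite -subr_gt0 => sl.
have infS : has_inf S.
  split; last by exists 0 => x [].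
  have [l' l'0 H] := indep_points_exists xi Q0 jm.
  by exists l'; split; [exact: ltW|exact/has_lin_indepP].
have [e [e0 /(has_lin_indep_ge0 e0) He]] := inf_adherent sl infS.
rewrite addrC subrK => /ltW el.
by apply: indep_points_mono He => //; rewrite ler_pM2r ?invr_gt0.
Qed.

(** * Spans of integer points and pivot columns *)

Lemma row_free_col_mx (F : fieldType) p m (X : 'M[F]_(p, m)) (x : 'rV[F]_m) :
  row_free X -> ~~ (x <= X)%MS -> row_free (col_mx X x).
Proof.
move=> Xfree xX; rewrite /row_free eqn_leq rank_leq_row andTb -addsmxE addn1.
have /eqP rX := Xfree; rewrite -[X in (X < _)%N]rX.
apply: rank_ltmx; rewrite /ltmx addsmxSl /=.
by apply: contra xX => /(submx_trans _)-> //; exact: addsmxSr.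
Qed.

Lemma indep_points_col_mx (R : realType) m (xi : 'rV[R]_m) Q l j
    (X : 'M[R]_(j, m)) x :
  row_free X -> (forall i, body_points xi Q l (row i X)) ->
  body_points xi Q l x -> ~~ (x <= X)%MS -> indep_points xi Q l j.+1.
Proof.
move=> Xf XG xG xX; rewrite -addn1; exists (col_mx X x).
split; first exact: row_free_col_mx.
move=> i; case: (split_ordP i) => k ->; first by rewrite rowKu.
by rewrite rowKd row_id.
Qed.

(** Induction on [j] selects a maximal free family; its size [r] may fall short of [j]. *)
Lemma body_points_span (R : realType) m (xi : 'rV[R]_m) (Q l : R) j :
  ~ indep_points xi Q l j.+1 ->
  exists r (X : 'M[R]_(r, m)), [/\ (r <= j)%N, row_free X &
    forall x, body_points xi Q l x -> (x <= X)%MS].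
Proof.
elim: j => [|j IHj] Hj.
  exists 0%N, 0; split=> //; first by rewrite /row_free mxrank0.
  move=> x xG; apply: contrapT => /negP xX; apply: Hj.
  apply: (@indep_points_col_mx _ _ _ _ _ 0 0 x) => //; last by case.
  by rewrite /row_free mxrank0.
have [[X [Xf XG]]|/IHj[r [X [rj Xf XG]]]] := pselect (indep_points xi Q l j.+1).
  exists j.+1, X; split=> // x xG; apply: contrapT => /negP xX.
  by apply: Hj; apply: indep_points_col_mx Xf XG xG xX.
by exists r, X; split=> //; exact: leqW.
Qed.

Lemma pivot_columns (F : fieldType) r m (X : 'M[F]_(r, m)) :
  row_free X ->
  exists2 f : 'I_r -> 'I_m, injective f & colsub f X \in unitmx.
Proof.
move=> Xf; have Xtf : row_full X^T by rewrite /row_full mxrank_tr.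
exists (fullrankfun Xtf); first exact: fullrankfun_inj.
by rewrite -unitmx_tr trmx_mxsub fullrowsub_unit.
Qed.

Lemma pivot_eq0 (F : fieldType) r m (X : 'M[F]_(r, m)) (f : 'I_r -> 'I_m)
    (x : 'rV[F]_m) :
  colsub f X \in unitmx -> (x <= X)%MS -> (forall i, x ord0 (f i) = 0) -> x = 0.
Proof.
move=> Xu /submxP[u ->] u0.
suff -> : u = 0 by rewrite mul0mx.
rewrite -[u](mulmxK Xu) mulmx_colsub.
rewrite (_ : colsub f _ = 0) ?mul0mx//.
by apply/rowP => i; rewrite !mxE -[RHS](u0 i) mxE.
Qed.

(** * Upper bound for a minimum by pigeonhole *)

Lemma norm_dotv_le (R : realType) m (x xi : 'rV[R]_m) (a : R) :
  (forall i, `|x ord0 i| <= a) -> `|dotv x xi| <= a * \sum_i `|xi ord0 i|.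
Proof.
move=> xa; rewrite /dotv mulr_sumr; apply: le_trans (ler_norm_sum _ _ _) _.
by apply: ler_sum => i _; rewrite normrM ler_wpM2r.
Qed.

(* The integer points with coordinates in [0, T] vanishing on the pivot columns
   of X are pairwise distinct modulo the row space of X; were there more of them
   than intervals of length l / Q for their scalar product with xi, two would
   differ by an element of body_points outside that row space. *)
Lemma pigeonhole_bound (R : realType) m (xi : 'rV[R]_m) (Q l : R) j :
  1 <= Q -> (0 < m)%N -> m%:R <= l -> ~ indep_points xi Q l j.+1 ->
  (Num.truncn (l / m%:R))%:R ^+ (m - j) <= (2 * (\sum_i `|xi ord0 i|) + 1) * Q.
Proof.
move=> Q1 m0 ml /body_points_span[r [X [rj Xf XG]]].
have m0' : (0 : R) < m%:R by rewrite ltr0n.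
have l0 : 0 < l by exact: lt_le_trans ml.
have Q0 : 0 < Q by exact: lt_le_trans Q1.
set B := \sum_i _.
have B0 : 0 <= B by apply: sumr_ge0.
have lm1 : 1 <= l / m%:R by rewrite ler_pdivlMr// mul1r.
set T := Num.truncn _.
have T1 : (0 < T)%N by rewrite truncn_gt0.
have Tl : T%:R <= l / m%:R by rewrite truncn_le (le_trans _ lm1).
have mTl : m%:R * T%:R <= l by rewrite mulrC -ler_pdivlMr.
have Tl' : T%:R <= l.
  by apply: le_trans mTl; rewrite ler_peMl// ler1n.
have [f finj fu] := pivot_columns Xf.
(* From here on [T.+1] is the integer part of [l / m], so a coordinate in ['I_T.+1] takes exactly
   that many values. *)
case: T T1 Tl mTl Tl' => // T _ Tl mTl Tl'.
pose D := [pred c | c \notin codom f].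
have cD : #|D| = (m - r)%N.
  have := cardC (mem (codom f)); rewrite card_codom// !card_ord => /esym mE.
  by rewrite [X in (X - _)%N]mE addKn.
pose pt (g : {ffun 'I_m -> 'I_T.+1}) : 'rV[R]_m := \row_c (g c : nat)%:R.
(* Shifted to be nonnegative, and rescaled so that intervals of length [l / Q] become unit
   intervals. *)
pose y g := (dotv (pt g) xi + T.+1%:R * B) * Q / l.
have ptT g i : `|pt g ord0 i| <= T.+1%:R.
  by rewrite mxE normr_nat ler_nat ltnW.
have y0 g : 0 <= y g.
  rewrite /y divr_ge0 ?(ltW l0)// mulr_ge0 ?(ltW Q0)//.
  by have := norm_dotv_le xi (ptT g); rewrite ler_norml => /andP[+ _]; rewrite -lerBlDr sub0r.
have yle g : y g <= 2 * B * Q.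
  rewrite /y ler_pdivrMr// mulrAC ler_pM2r//.
  apply: (@le_trans _ _ (2 * (T.+1%:R * B))).
    by have := le_trans (ler_norm _) (norm_dotv_le xi (ptT g)); rewrite -/B; lra.
  by rewrite -[leRHS]mulrA ler_pM2l// mulrC ler_wpM2l.
pose N := Num.truncn (2 * B * Q).
have NE : N.+1%:R <= (2 * B + 1) * Q.
  rewrite mulrDl mul1r -natr1 lerD// truncn_le.
  by rewrite !mulr_ge0// ltW.
pose box g : 'I_N.+1 := inord (Num.truncn (y g)).
have boxE g : (box g : nat) = Num.truncn (y g).
  by rewrite inordK// ltnS; apply: le_truncn.
have boxinj : {in pffun_on ord0 D predT &, injective box}.
  move=> g h /pffun_onP[gD _] /pffun_onP[hD _] /(congr1 val).
  rewrite /= !boxE => ygh.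
  have ygh1 : `|y g - y h| <= 1.
    have := truncn_itv (y0 g); have := truncn_itv (y0 h); rewrite ygh -natr1.
    move=> /andP[a1 a2] /andP[a3 a4]; rewrite ler_norml; lra.
  have dgh : `|dotv (pt g - pt h) xi| <= l / Q.
    rewrite ler_pdivlMr// dotvBl.
    have -> : dotv (pt g) xi - dotv (pt h) xi = (y g - y h) * (l / Q).
      by rewrite /y; field; rewrite !gt_eqF.
    rewrite normrM (gtr0_norm (divr_gt0 l0 Q0)) -mulrA divfK ?gt_eqF//.
    by rewrite ler_piMl// ltW.
  have ghG : body_points xi Q l (pt g - pt h).
    split=> //.
      by move=> i; rewrite !mxE rpredB// ?natr_int// intr_nat.
    apply: le_trans (eucl_norm_le_sum _) mTl => i.
    have := ltn_ord (g i); have := ltn_ord (h i).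
    rewrite !mxE -(ltr_nat R) -[(g i < _)%N](ltr_nat R).
    have := ler0n R (g i); have := ler0n R (h i).
    by move=> *; rewrite ler_norml; lra.
  have gh0 : pt g - pt h = 0.
    apply: pivot_eq0 fu (XG _ ghG) _ => i.
    have fi : f i \notin D by rewrite inE negbK codom_f.
    have ghi : g (f i) = h (f i).
      by move/supportP/(_ _ fi): gD => ->; move/supportP/(_ _ fi): hD => ->.
    by rewrite !mxE ghi subrr.
  apply/ffunP => c; apply/val_inj => /=.
  move/rowP/(_ c): gh0; rewrite !mxE => /eqP; rewrite subr_eq0 eqr_nat.
  by move/eqP.
have := leq_card_in box _ boxinj.
rewrite card_pffun_on cD cardT size_enum_ord card_ord => cardle.
apply: le_trans NE; rewrite -natrX ler_nat.
by apply: leq_trans cardle; rewrite leq_pexp2l// leq_sub2l.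
Qed.

(** The pigeonhole bound is applied at half the minimum, where [j.+1] independent points do not
    exist. *)
Lemma succ_min_upper (R : realType) m (xi : 'rV[R]_m) j :
  (j < m)%N ->
  exists2 C : R, 0 < C & forall Q, 1 <= Q ->
    succ_min (cbody xi Q) (@int_lattice R m) j.+1 ^+ (m - j) <= C * Q.
Proof.
move=> jm; have m0 : (0 < m)%N by exact: leq_ltn_trans jm.
have m0' : (0 : R) < m%:R by rewrite ltr0n.
set B := \sum_i `|xi ord0 i|.
have B0 : 0 <= B by apply: sumr_ge0.
have B1 : 1 <= 2 * B + 1 by lra.
exists ((2 * B + 1) * (4 * m%:R) ^+ (m - j)).
  by rewrite mulr_gt0// ?exprn_gt0 ?mulr_gt0//; lra.
move=> Q Q1; have Q0 : 0 < Q by exact: lt_le_trans Q1.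
have := succ_min_ge1 xi Q0 jm; set s := succ_min _ _ _ => s1.
rewrite mulrAC mulrC.
have [sm|ms] := ltP (s / 2) m%:R.
  have : s ^+ (m - j) <= (4 * m%:R) ^+ (m - j).
    by apply: lerXn2r; rewrite ?nnegrE; lra.
  move/le_trans; apply; rewrite ler_peMr ?exprn_ge0 ?mulr_ge0 ?(ltW m0')//.
  by rewrite -[leLHS]mulr1 ler_pM.
have nind : ~ indep_points xi Q (s / 2) j.+1.
  by move/succ_min_le; rewrite -/s; lra.
have := pigeonhole_bound Q1 m0 ms nind; rewrite -/B => H.
rewrite mulrC -ler_pdivrMr; last by rewrite exprn_gt0// mulr_gt0.
apply: le_trans H; rewrite -expr_div_n; apply: lerXn2r; rewrite ?nnegrE//.
  by rewrite divr_ge0//; lra.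
(* For [x >= 1] the integer part of [x] is at least [x / 2]; with [x = s / (2 m)] this accounts for
   the 4 in the constant. *)
have x1 : 1 <= s / 2 / m%:R by rewrite ler_pdivlMr// mul1r.
have /andP[_] := truncn_itv (le_trans ler01 x1).
have : (1 <= Num.truncn (s / 2 / m%:R))%N by rewrite truncn_gt0.
rewrite -(ler_nat R) -natr1.
have -> : s / (4 * m%:R) = s / 2 / m%:R / 2 by field; rewrite gt_eqF.
by lra.
Qed.

(** * Lower bound from determinants on a rational subspace *)

(** This is where rational independence enters: an integer vector orthogonal to [xi] is a rational
    relation between the coordinates of [xi]. *)
Lemma int_dotv_eq0 (R : realType) m (xi x : 'rV[R]_m) :
  Q_lin_indep_coords xi -> int_lattice x -> dotv x xi = 0 -> x = 0.
Proof.
move=> xiQ xint x0; pose c i : rat := (Num.floor (x ord0 i))%:~R.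
have cE i : ratr (c i) = x ord0 i by rewrite ratr_int floorK ?xint.
have c0 : \sum_i ratr (c i) * xi ord0 i = 0.
  by rewrite -[RHS]x0; apply: eq_bigr => i _; rewrite cE.
by apply/rowP => i; rewrite mxE -cE (xiQ _ c0) raddf0.
Qed.

(** In the Leibniz expansion each term is at most the product of the bounds of the rows other than
    [i], and there are at most p! terms. *)
Lemma cofactor_norm_le (R : realFieldType) p (A : 'M[R]_p) (rho : 'I_p -> R) i j :
  (forall a b, `|A a b| <= rho a) ->
  `|cofactor A i j| <= p`!%:R * \prod_(a | i != a) rho a.
Proof.
move=> Arho; rewrite expand_cofactor; apply: le_trans (ler_norm_sum _ _ _) _.
have rho0 a : 0 <= rho a by apply: le_trans (Arho a a).
apply: (@le_trans _ _ (\sum_(s : {perm 'I_p}) \prod_(a | i != a) rho a)).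
  rewrite [leRHS](bigID (fun s : {perm 'I_p} => s i == j))/=.
  rewrite -[leLHS]addr0 lerD ?sumr_ge0//; last by move=> *; exact: prodr_ge0.
  apply: ler_sum => s _; rewrite normrM normrX normrN1 expr1n mul1r normr_prod.
  by apply: ler_prod => a _; rewrite normr_ge0 Arho.
by rewrite sumr_const card_Sn mulr_natl.
Qed.

(* On the row space of W, the form (dotv _ xi) is a nonzero combination eta of the
   pivot coordinates. The minor of X on the pivot columns is a nonzero integer, and
   Cramer's rule solves for eta in terms of the scalar products with xi. *)
Lemma det_lower_bound (R : realType) m (xi : 'rV[R]_m) p (W : 'M[R]_(p, m)) :
  (0 < p)%N -> Q_lin_indep_coords xi -> row_free W ->
  (forall i, int_lattice (row i W)) ->
  exists2 c : R, 0 < c & forall Q (X : 'M[R]_(p, m)) (rho : 'I_p -> R),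
    0 < Q -> (X <= W)%MS -> row_free X ->
    (forall i, body_points xi Q (rho i) (row i X)) ->
    c * Q <= \prod_i rho i.
Proof.
move=> p0 xiQ Wfree Wint.
have [f _ Au] := pivot_columns Wfree.
pose eta := invmx (colsub f W) *m (W *m xi^T).
have etaE : colsub f W *m eta = W *m xi^T by rewrite /eta mulKVmx.
clearbody eta.
(* If [eta] vanished, [xi] would be orthogonal to the rows of [W], which are nonzero integer
   vectors. *)
have [a eta0] : exists a, eta a ord0 != 0.
  apply/not_existsP => H.
  have eta0 : eta = 0.
    apply/colP => a; rewrite [RHS]mxE; apply/eqP.
    by move/negP: (H a); rewrite negbK.
  have := row_free_row_neq0 (Ordinal p0) Wfree; rewrite (int_dotv_eq0 xiQ (Wint _)) ?eqxx//.
  by rewrite dotvE -row_mul -etaE eta0 mulmx0 !mxE.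
have pf0 : 0 < p%:R * p`!%:R :> R by rewrite mulr_gt0// ltr0n// fact_gt0.
exists (`|eta a ord0| / (p%:R * p`!%:R)); first by rewrite divr_gt0// normr_gt0.
move=> Q X rho Q0 /submxP[U XE] Xfree XG.
have Xle b c : `|X b c| <= rho b.
  case: (XG b) => _ Xb _; apply: le_trans Xb.
  by have := coord_le_eucl_norm (row b X) c; rewrite mxE.
have Uu : U \in unitmx.
  rewrite -row_free_unit /row_free eqn_leq rank_leq_row /=.
  by move/eqP: Xfree => {1}<-; rewrite XE mxrankM_maxl.
have XIE : colsub f X = U *m colsub f W by rewrite XE mulmx_colsub.
have det1 : 1 <= `|\det (colsub f X)|.
  apply: norm_intr_ge1.
    rewrite /determinant rpred_sum// => s _; rewrite rpredM ?rpredX ?rpredN1//.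
    rewrite rpred_prod// => b _; rewrite mxE.
    by case: (XG b) => /(_ (f (s b))); rewrite mxE.
  by rewrite -unitfE -unitmxE XIE unitmx_mul Uu.
have adjE : \det (colsub f X) *: eta = \adj (colsub f X) *m (X *m xi^T).
  by rewrite {3}XE -mulmxA -etaE [U *m _]mulmxA -XIE mulmxA mul_adj_mx mul_scalar_mx.
have : `|eta a ord0| <= p%:R * p`!%:R * (\prod_i rho i) / Q.
  apply: (@le_trans _ _ `|(\det (colsub f X) *: eta) a ord0|).
    by rewrite mxE normrM ler_peMl.
  rewrite adjE mxE; apply: le_trans (ler_norm_sum _ _ _) _.
  have -> : p%:R * p`!%:R * (\prod_i rho i) / Q =
      \sum_(b < p) (p`!%:R * (\prod_i rho i) / Q).
    by rewrite sumr_const card_ord -!mulrA mulr_natl.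
  apply: ler_sum => b _; rewrite normrM [\adj _ _ _]mxE (bigD1 b)//=.
  (* The cofactor supplies the bounds of all rows except [b]; row [b] contributes its scalar product
     with [xi], at most [rho b / Q]. *)
  have -> : p`!%:R * (rho b * \prod_(i < p | i != b) rho i) / Q =
      (p`!%:R * \prod_(i < p | b != i) rho i) * (rho b / Q).
    by under eq_bigl do rewrite eq_sym; ring.
  apply: ler_pM => //; first by apply: cofactor_norm_le => i j; rewrite mxE.
  by case: (XG b) => _ _; rewrite dotvE -row_mul [(row _ _) _ _]mxE.
rewrite ler_pdivlMr// => H.
by rewrite mulrAC ler_pdivrMr// [leRHS]mulrC.
Qed.

(** * Comparison of minima across parameters and indices *)

Lemma body_points_le (R : realType) m (xi : 'rV[R]_m) (Q Q' l l' : R) x :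
  0 < Q -> Q <= Q' -> 0 <= l -> l <= l' ->
  body_points xi Q' l x -> body_points xi Q l' x.
Proof.
move=> Q0 QQ l0 ll [xint xl xxi]; split=> //; first exact: le_trans ll.
apply: le_trans xxi _; rewrite ler_pM// ?invr_ge0 ?(le_trans (ltW Q0))//.
by rewrite lef_pV2 ?posrE// (lt_le_trans Q0).
Qed.

Lemma indep_pointsW (R : realType) m (xi : 'rV[R]_m) (Q l : R) j :
  indep_points xi Q l j.+1 -> indep_points xi Q l j.
Proof.
rewrite -addn1 => -[X [/row_freeP[Y XY] XG]]; exists (usubmx X); split.
  apply/row_freeP; exists (Y *m col_mx 1%:M 0).
  by rewrite mulmxA mul_usub_mx XY mul_usub_mx mul1mx col_mxKu.
by move=> i; have := XG (lshift 1 i); rewrite row_usubmx.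
Qed.

Lemma succ_min_double (R : realType) m (xi : 'rV[R]_m) (Q : R) j :
  0 < Q -> (j < m)%N ->
  indep_points xi Q (2 * succ_min (cbody xi Q) (@int_lattice R m) j.+1) j.+1.
Proof.
by move=> Q0 jm; apply: succ_min_lt => //; have := succ_min_ge1 xi Q0 jm; lra.
Qed.

Lemma succ_min_monoS (R : realType) m (xi : 'rV[R]_m) (Q : R) j :
  0 < Q -> (j.+1 < m)%N ->
  succ_min (cbody xi Q) (@int_lattice R m) j.+1 <=
  succ_min (cbody xi Q) (@int_lattice R m) j.+2.
Proof.
move=> Q0 jm; apply/ler_addgt0Pr => e e0.
by apply/succ_min_le/indep_pointsW/succ_min_lt => //; rewrite ltrDl.
Qed.

(** The larger factor offsets the narrowing of the slab, as [a * l / (a * Q) = l / Q]. The 2 is the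
    price of an infimum not known to be attained. *)
Lemma succ_min_scale (R : realType) m (xi : 'rV[R]_m) (Q a : R) j :
  0 < Q -> 1 <= a -> (j < m)%N ->
  succ_min (cbody xi (a * Q)) (@int_lattice R m) j.+1 <=
  a * (2 * succ_min (cbody xi Q) (@int_lattice R m) j.+1).
Proof.
move=> Q0 a1 jm; have a0 : 0 < a by exact: lt_le_trans a1.
apply: succ_min_le; apply: indep_points_mono (succ_min_double xi Q0 jm).
  by rewrite ler_peMl// mulr_ge0// (le_trans ler01 (succ_min_ge1 xi Q0 jm)).
by rewrite -mulf_div divff ?mul1r// gt_eqF.
Qed.

(** * Stationarity of the span under a persistent gap *)

Lemma body_points_sub (R : realType) m (xi : 'rV[R]_m) (Q l : R) j
    (X : 'M[R]_(j, m)) x :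
  l < succ_min (cbody xi Q) (@int_lattice R m) j.+1 ->
  row_free X -> (forall i, body_points xi Q l (row i X)) ->
  body_points xi Q l x -> (x <= X)%MS.
Proof.
move=> ls Xf XG xG; apply: contraT => xX.
by have := succ_min_le (indep_points_col_mx Xf XG xG xX); rewrite leNgt ls.
Qed.

(* The points of the dilate at time i+1 already lie in the dilate at time i by
   a factor below the (p+2)-th minimum, so their span can only shrink with i. *)
Lemma stationary_span (R : realType) m (xi : 'rV[R]_m) p N :
  (p.+1 < m)%N ->
  (forall i, (N <= i)%N ->
    4 * expR 1 * succ_min (cbody xi (expR i%:R)) (@int_lattice R m) p.+1 <
    succ_min (cbody xi (expR i%:R)) (@int_lattice R m) p.+2) ->
  exists W : 'M[R]_(p.+1, m), [/\ row_free W, forall a, int_lattice (row a W) &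
    forall i x, (N <= i)%N ->
      body_points xi (expR i%:R)
        (2 * succ_min (cbody xi (expR i%:R)) (@int_lattice R m) p.+1) x ->
      (x <= W)%MS].
Proof.
move=> pm gap; have pm' : (p < m)%N by exact: ltnW.
pose s i := succ_min (cbody xi (expR i%:R)) (@int_lattice R m) p.+1.
have Q0 i : 0 < expR i%:R :> R by exact: expR_gt0.
have s1 i : 1 <= s i by exact: succ_min_ge1.
have e1 : 1 < expR 1 :> R by rewrite -expR0 ltr_expR.
have e4s i : 4 * s i <= 4 * expR 1 * s i.
  by rewrite mulrAC ler_peMr ?ltW// mulr_gt0//; have := s1 i; lra.
(* One step in [i] multiplies Q by e, so [s i.+1] is at most [2 e s i]; doubling gives the constant
   4e of the gap. *)
have sS i : 2 * s i.+1 <= 4 * expR 1 * s i.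
  have := succ_min_scale xi (Q0 i) (ltW e1) pm'.
  by rewrite -expRD -[1 + i%:R]/(1%:R + i%:R) -natrD add1n -/(s _) -/(s _); lra.
have [W [Wf WG]] := succ_min_double xi (Q0 N) pm'.
exists W; split=> //; first by move=> a; case: (WG a).
have WE i : (N <= i)%N -> forall x,
    body_points xi (expR i%:R) (2 * s i) x -> (x <= W)%MS.
  elim: i => [|i IHi]; rewrite leq_eqVlt => /orP[/eqP NE|//].
  - subst N => x; apply: body_points_sub Wf WG.
    by apply: le_lt_trans (gap 0%N _) => //; have := e4s 0%N; have := s1 0%N; rewrite /s; lra.
  - rewrite -NE => x; apply: body_points_sub Wf WG.
    by apply: le_lt_trans (gap N _) => //; have := e4s N; have := s1 N; rewrite /s; lra.
  rewrite ltnS => Ni x xG.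
  have [V [Vf VG]] := succ_min_double xi (Q0 i) pm'.
  have VW : (V <= W)%MS by apply/row_subP => a; exact: IHi (VG a).
  apply: submx_trans VW; apply: body_points_sub (gap i Ni) Vf _ _.
    move=> a; apply: body_points_le (VG a) => //.
      by have := s1 i; rewrite /s; lra.
    by have := e4s i; have := s1 i; rewrite /s; lra.
  apply: body_points_le xG => //.
    by rewrite ler_expR ler_nat.
  by have := s1 i.+1; lra.
by move=> i x Ni; exact: WE.
Qed.

(** Independent points for the lower minimum, completed by one point for the next minimum, form a
    basis of the fixed subspace [W], to which the determinant bound applies. *)
Lemma stationary_lower_bound (R : realType) m (xi : 'rV[R]_m) p N :
  (p.+2 < m)%N -> Q_lin_indep_coords xi ->
  (forall i, (N <= i)%N ->
    4 * expR 1 * succ_min (cbody xi (expR i%:R)) (@int_lattice R m) p.+2 <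
    succ_min (cbody xi (expR i%:R)) (@int_lattice R m) p.+3) ->
  exists2 c : R, 0 < c & forall i, (N <= i)%N ->
    c * expR i%:R <=
    succ_min (cbody xi (expR i%:R)) (@int_lattice R m) p.+1 ^+ p.+1 *
    succ_min (cbody xi (expR i%:R)) (@int_lattice R m) p.+2.
Proof.
move=> pm xiQ gap; have [pm1 pm2] : (p.+1 < m)%N /\ (p < m)%N by split; lia.
have [W [Wf Wint WE]] := stationary_span pm gap.
rewrite -addn1 in W Wf Wint WE.
have [c c0 cE] := det_lower_bound (isT : 0 < p.+1 + 1)%N xiQ Wf Wint.
(* Each of the [p.+2] rows is taken at twice its minimum. *)
exists (c / 2 ^+ p.+2); first by rewrite divr_gt0// exprn_gt0.
move=> i Ni; have Q0 : 0 < expR i%:R :> R by exact: expR_gt0.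
set s := succ_min _ _ p.+1; set t := succ_min _ _ p.+2.
have {}WE x : body_points xi (expR i%:R) (2 * t) x -> (x <= W)%MS.
  by rewrite /t -[p.+2]addn1; exact: WE.
have st : s <= t by exact: succ_min_monoS.
have s1 : 1 <= s by exact: succ_min_ge1.
have [X [Xf XG]] := succ_min_double xi Q0 pm2.
have [Y [Yf YG]] := succ_min_double xi Q0 pm1.
(* [Y] has larger rank than [X], so one of its rows escapes the row space of [X]. *)
have [b Yb] : exists b, ~~ (row b Y <= X)%MS.
  apply/row_subPn/negP => /mxrankS; move/eqP: Yf => ->.
  by rewrite leqNgt ltnS rank_leq_row.
pose rho (a : 'I_(p.+1 + 1)) : R := if fintype.split a is inl _ then 2 * s else 2 * t.
have := cE _ (col_mx X (row b Y)) rho Q0.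
have -> : \prod_a rho a = (2 * s) ^+ p.+1 * (2 * t).
  rewrite big_split_ord/= big_ord1 /rho; congr (_ * _); last first.
    by rewrite (unsplitK (inr ord0)).
  rewrite -[in RHS](card_ord p.+1) -prodr_const; apply: eq_bigr => a _.
  by rewrite (unsplitK (inl a)).
rewrite mulrAC ler_pdivrMr ?exprn_gt0// exprMn => H.
have {H} := H _ (row_free_col_mx Xf Yb) _.
have -> : 2 ^+ p.+1 * s ^+ p.+1 * (2 * t) = s ^+ p.+1 * t * 2 ^+ p.+2.
  by rewrite [2 ^+ p.+2]exprSr; ring.
apply.
  rewrite col_mx_sub (WE _ (YG b)) andbT; apply/row_subP => a.
  apply: WE; apply: body_points_le (XG a) => //; rewrite -/s -/t; lra.
move=> a; rewrite /rho; case: split_ordP => k ->.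
  by rewrite rowKu.
by rewrite rowKd row_id.
Qed.

(** * Recurrence of small gaps and the bound on the lower limit *)

Lemma frequent_small_gap (R : realType) m (xi : 'rV[R]_m) p :
  (p.+2 < m)%N -> Q_lin_indep_coords xi ->
  (forall eps : R, 0 < eps -> exists N, forall i, (N <= i)%N ->
    ln (succ_min (cbody xi (expR i%:R)) (@int_lattice R m) p.+1) <= eps * i%:R) ->
  forall N, exists2 i, (N <= i)%N &
    succ_min (cbody xi (expR i%:R)) (@int_lattice R m) p.+3 <=
    4 * expR 1 * succ_min (cbody xi (expR i%:R)) (@int_lattice R m) p.+2.
Proof.
move=> pm xiQ small N; have [pm1 pm2] : (p.+1 < m)%N /\ (p < m)%N by split; lia.
(* An exponent at least 2 turns the pigeonhole bound into [t ^+ 2 <= C * Q]. *)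
have m2 : (2 <= m - p.+1)%N by lia.
apply: contrapT => nogap.
have gap i : (N <= i)%N ->
    4 * expR 1 * succ_min (cbody xi (expR i%:R)) (@int_lattice R m) p.+2 <
    succ_min (cbody xi (expR i%:R)) (@int_lattice R m) p.+3.
  by move=> Ni; rewrite ltNge; apply/negP => H; apply: nogap; exists i.
have [c c0 cE] := stationary_lower_bound pm xiQ gap.
have [C C0 CE] := succ_min_upper xi pm1.
have p0 : 0 < p.+1%:R :> R by rewrite ltr0n.
(* This choice gives [s ^+ p.+1 <= Q^(1/4)], hence [t >= c Q^(3/4)]. Together with [t ^+ 2 <= C * Q]
   this bounds [i] by [4 (ln C / 2 - ln c)], which the [i] chosen next exceeds. *)
have [|N' N'E] := small ((4 * p.+1%:R)^-1); first by rewrite invr_gt0 mulr_gt0.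
pose i := maxn (maxn N N') (Num.truncn (4 * (ln C / 2 - ln c))).+1.
have Ni : (N <= i)%N by lia.
have N'i : (N' <= i)%N by lia.
have iB : 4 * (ln C / 2 - ln c) < i%:R.
  by apply: lt_le_trans (truncnS_gt _) _; rewrite ler_nat leq_maxr.
clearbody i.
have Q0 : 0 < expR i%:R :> R by exact: expR_gt0.
have Q1 : 1 <= expR i%:R :> R by rewrite -expR0 ler_expR.
move: (cE i Ni) (CE _ Q1) (N'E i N'i) (succ_min_ge1 xi Q0 pm1) (succ_min_ge1 xi Q0 pm2).
set s := succ_min _ _ p.+1; set t := succ_min _ _ p.+2 => Hc HC Hs t1 s1.
have s0 : 0 < s := lt_le_trans ltr01 s1.
have t0 : 0 < t := lt_le_trans ltr01 t1.
have : ln (t ^+ 2) <= ln (C * expR i%:R).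
  rewrite ler_ln ?posrE ?mulr_gt0 ?exprn_gt0//; apply: le_trans HC.
  exact: ler_weXn2l.
move: Hc; rewrite -ler_ln ?posrE ?mulr_gt0 ?exprn_gt0//.
rewrite !lnM ?posrE ?exprn_gt0// !lnXn// !expRK.
rewrite -[ln s *+ _]mulr_natl.
have : p.+1%:R * ln s <= i%:R / 4.
  rewrite -ler_pdivlMl//; apply: le_trans Hs _.
  by rewrite invfM -mulrA mulrCA [_^-1 * i%:R]mulrC.
by lra.
Qed.

Theorem theorem3 (R : realType) (n k : nat) (xi : 'rV[R]_n.+1) :
  (2 <= n)%N -> (2 <= k <= n)%N ->
  Q_lin_indep_coords xi ->
  log_succ_min xi (k - 1)%N q / q @[q --> +oo] --> (0 : R) ->
  (limf_einf (fun q : R => (log_succ_min xi (k + 1)%N q / q)%:E) (+oo_R)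
     <= (1 / (n%:R - k%:R + 2%:R))%:E)%E.
Proof.
move=> _ /andP[]; case: k => [//|[//|p]] _ pn xiQ.
rewrite subn1 addn1 /= => lim0.
have pm : (p.+2 < n.+1)%N by [].
(* With [k = p.+2], the denominator is the exponent in the pigeonhole bound for the [k]-th
   minimum. *)
have -> : n%:R - p.+2%:R + 2%:R = (n.+1 - p.+1)%:R :> R.
  have pn' : (p <= n)%N by lia.
  by rewrite subSS natrB// -addn2 natrD; ring.
set d := (n.+1 - p.+1)%N.
have d0 : (0 : R) < d%:R by rewrite ltr0n /d; lia.
(* The limit is specialized to natural [q]; the maximum with 0 keeps [i] positive for clearing the
   denominator. *)
have small (eps : R) : 0 < eps -> exists N, forall i, (N <= i)%N ->
    ln (succ_min (cbody xi (expR i%:R)) (@int_lattice R n.+1) p.+1) <= eps * i%:R.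
  move=> eps0; move/cvgrPdist_le/(_ _ eps0): lim0 => -[M [_ ME]].
  exists (Num.truncn (Num.max M 0)).+1 => i Ni.
  have : Num.max M 0 < i%:R.
    by apply: lt_le_trans (truncnS_gt _) _; rewrite ler_nat.
  rewrite gt_max => /andP[/ME/=+ i0].
  by rewrite sub0r normrN ler_norml => /andP[_]; rewrite ler_pdivrMr.
have [C C0 CE] := succ_min_upper xi (ltnW pm).
(* The lower limit is the supremum, over neighbourhoods [A] of infinity, of the infima on [A]; for
   each [eps], one point of [A] with quotient at most [1 / d + eps] suffices. *)
rewrite limf_einfE; apply: ge_ereal_sup => _ [A [M [_ MA]] <-].
apply/lee_addgt0Pr => eps eps0.
(* [K] collects the losses independent of [i], from the gap factor and the pigeonhole constant; for
   [i > K / eps] they stay below [eps * i]. *)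
pose K := ln (4 * expR 1) + ln C / d%:R.
have [i Ni gap] := frequent_small_gap pm xiQ small
  (Num.truncn (Num.max M (Num.max 0 (K / eps)))).+1.
have : Num.max M (Num.max 0 (K / eps)) < i%:R.
  by apply: lt_le_trans (truncnS_gt _) _; rewrite ler_nat.
rewrite !gt_max => /and3P[Mi i0 Ki].
apply: (@le_trans _ _ (log_succ_min xi p.+3 i%:R / i%:R)%:E).
  by apply: ereal_inf_lbound; exists i%:R => //; exact: MA.
rewrite -EFinD lee_fin /log_succ_min ler_pdivrMr//.
have Q0 : 0 < expR i%:R :> R by exact: expR_gt0.
have Q1 : 1 <= expR i%:R :> R by rewrite -expR0 ler_expR.
move: gap (CE _ Q1) (succ_min_ge1 xi Q0 (ltnW pm)) (succ_min_ge1 xi Q0 pm).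
rewrite -/d; set s := succ_min _ _ p.+2; set t := succ_min _ _ p.+3 => gap sC s1 t1.
have s0 : 0 < s := lt_le_trans ltr01 s1.
have t0 : 0 < t := lt_le_trans ltr01 t1.
have e0 : 0 < 4 * expR 1 :> R by rewrite mulr_gt0// expR_gt0.
have lt : ln t <= ln (4 * expR 1) + ln s.
  by rewrite -lnM ?posrE// ler_ln ?posrE// mulr_gt0.
have ls : ln s <= ln C / d%:R + i%:R / d%:R.
  rewrite -mulrDl ler_pdivlMr// mulr_natr -lnXn// -[X in _ <= _ + X]expRK.
  by rewrite -lnM ?posrE// ler_ln ?posrE ?exprn_gt0// mulr_gt0.
have : K <= eps * i%:R by rewrite mulrC -ler_pdivrMr// ltW.
rewrite [X in _ -> _ <= X]mulrDl div1r [d%:R^-1 * _]mulrC /K; lra.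
Qed.
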